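(* Let $n \geq 4$ be a natural number and let $f_n = f_n(x_1, \ldots, x_n)$ be the Boolean function on $\{0,1\}^n$ given by the DNF $$x_1 x_2 \vee x_1 x_3 \vee \dots \vee x_1 x_{n-1} \vee x_2 x_3 \cdots x_n .$$ Then $f_n$ is a positive threshold function which depends on all its variables and is not linear read-once (in particular not nested), and the specification number of $f_n$ in the class $\mathcal{H}_n$ of threshold Boolean functions of $n$ variables is $n+1$.
   Context: A Boolean function $f$ on $B^n=\{0,1\}^n$ is a threshold function if there are reals $w_1,\dots,w_n,t$ such that for all $x\in B^n$, $f(x)=0$ iff $\sum_i w_i x_i \le t$. $\mathcal{H}_n$ denotes the class of threshold Boolean functions of $n$ variables. $f$ is positive if $f(x)=1$ and $x\le y$ coordinatewise imply $f(y)=1$. A variable $x_k$ is relevant for $f$ if $f_{|x_k=1}\not\equiv f_{|x_k=0}$ (restriction obtained by fixing $x_k$). A Boolean function is linear read-once if it is constant or representable by a nested formula, defined recursively: the literals $x$ and $\bar{x}$ are nested formulas; if $t$ is a nested formula containing neither $x$ nor $\bar x$, then $x\vee t$, $x\wedge t$, $\bar x\vee t$, $\bar x\wedge t$ are nested formulas. A linear read-once function depending on all its variables is called nested. For a class $\mathcal{F}$ of functions of $n$ variables and $f\in\mathcal{F}$, a set $S\subseteq B^n$ specifies $f$ in $\mathcal{F}$ if $f$ is the only function in $\mathcal{F}$ agreeing with $f$ on $S$; the specification number $\sigma_{\mathcal{F}}(f)$ is the minimum cardinality of such a set. *)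

(* Defs.v *)
From mathcomp Require Import all_boot all_order all_algebra.
From mathcomp Require Import boolp reals.

Set Implicit Arguments.
Unset Strict Implicit.
Unset Printing Implicit Defensive.

Import Order.TTheory GRing.Theory Num.Theory.

Definition cube (n : nat) := {ffun 'I_n -> bool}.

Definition boolfun (n : nat) := {ffun cube n -> bool}.

Definition threshold (R : realType) (n : nat) (f : boolfun n) : Prop :=
  exists (w : 'I_n -> R) (t : R), forall x : cube n,
    f x = false <-> (\sum_(i < n) w i * (x i)%:R <= t)%R.

Definition positive (n : nat) (f : boolfun n) : Prop :=
  forall x y : cube n, f x = true -> (forall i, x i <= y i) -> f y = true.

(* The point of B^n with k-th coordinate b and the other coordinates, in
   order, given by x. *)
Definition insert_coord (n : nat) (k : 'I_n) (b : bool) (x : cube n.-1)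
    : cube n :=
  [ffun i => if unlift k i is Some j then x j else b].

Definition restrict (n : nat) (f : boolfun n) (k : 'I_n) (b : bool)
    : boolfun n.-1 :=
  [ffun x => f (insert_coord k b x)].

Definition relevant (n : nat) (f : boolfun n) (k : 'I_n) : Prop :=
  restrict f k true <> restrict f k false.

Definition depends_on_all (n : nat) (f : boolfun n) : Prop :=
  forall k : 'I_n, relevant f k.

(* In each constructor, the pair (i, b) stands for the literal x_i if b is
   true and for its negation if b is false. *)
Inductive formula (n : nat) : Type :=
| Lit of 'I_n & bool
| LitOr of 'I_n & bool & formula n
| LitAnd of 'I_n & bool & formula n.

Fixpoint occurs (n : nat) (i : 'I_n) (t : formula n) : bool :=
  match t with
  | Lit j _ => i == j
  | LitOr j _ u | LitAnd j _ u => (i == j) || occurs i u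
  end.

Fixpoint nested_formula (n : nat) (t : formula n) : bool :=
  match t with
  | Lit _ _ => true
  | LitOr i _ u | LitAnd i _ u => ~~ occurs i u && nested_formula u
  end.

Definition eval_lit (n : nat) (i : 'I_n) (b : bool) (x : cube n) : bool :=
  if b then x i else ~~ x i.

Fixpoint eval (n : nat) (t : formula n) (x : cube n) : bool :=
  match t with
  | Lit i b => eval_lit i b x
  | LitOr i b u => eval_lit i b x || eval u x
  | LitAnd i b u => eval_lit i b x && eval u x
  end.

Definition linear_read_once (n : nat) (f : boolfun n) : Prop :=
  (exists b : bool, forall x, f x = b) \/
  (exists t : formula n, nested_formula t /\ forall x, f x = eval t x).

Definition nested (n : nat) (f : boolfun n) : Prop :=
  linear_read_once f /\ depends_on_all f.

(* Meant for f in F; membership of f in F is not part of the definition. *)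
Definition specifies (n : nat) (F : boolfun n -> Prop) (f : boolfun n)
    (S : {set cube n}) : Prop :=
  forall g : boolfun n, F g -> (forall x, x \in S -> g x = f x) -> g = f.

Lemma specifies_setT (n : nat) (F : boolfun n -> Prop) (f : boolfun n) :
  specifies F f [set: cube n].
Proof. by move=> g _ gf; apply/ffunP => x; apply: gf; rewrite inE. Qed.

(* By specifies_setT the starting point of the arg min is admissible, so this
   is the minimum of #|S| over all S specifying f. *)
Definition specification_number (n : nat) (F : boolfun n -> Prop)
    (f : boolfun n) : nat :=
  #|[arg min_(S < [set: cube n] | `[< specifies F f S >]) #|S|]|.

(* Coordinates numbered from 1: coord x k is x_k for 1 <= k <= n (and false for
   other k). *)
Definition coord (n : nat) (x : cube n) (k : nat) : bool :=
  [exists i : 'I_n, (i.+1 == k) && x i].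

Definition fn (n : nat) : boolfun n :=
  [ffun x : cube n =>
     \big[orb/false]_(2 <= k < n) (coord x 1 && coord x k)
     || \big[andb/true]_(2 <= k < n.+1) coord x k].

(* Main.v *)
(** The zeros and ones of [fn n] that matter are the [n - 1] points
    {x_1, x_i} (i > 1) and the two points {x_2, ..., x_n} and
    {x_2, ..., x_(n-1)}.  Flipping the value at any one of these [n + 1] points
    leaves a threshold function, so every specifying set contains all of them.
    Conversely, the values at these points force w_i > w_n > 0 for 1 < i < n
    and w_1 > 0, so that a threshold function agreeing with [fn n] there is
    monotone and its value at every other point follows.  A read-once formula
    becomes constant when its outermost literal is fixed suitably, whereas no
    variable of [fn n] has this effect. *)
Require Import Defs.
From mathcomp Require Import all_boot all_order all_algebra.
From mathcomp Require Import boolp reals.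
From mathcomp Require Import zify lra.

Set Implicit Arguments.
Unset Strict Implicit.
Unset Printing Implicit Defensive.

Import Order.TTheory GRing.Theory Num.Theory.

(** * Points as sets of coordinates; relevant variables and read-once functions *)

Definition indicator n (A : {set 'I_n}) : cube n := [ffun i => i \in A].

Definition support n (x : cube n) : {set 'I_n} := [set i | x i].

Lemma indicatorK n : cancel (@indicator n) (@support n).
Proof. by move=> A; apply/setP => i; rewrite inE ffunE. Qed.

Lemma supportK n : cancel (@support n) (@indicator n).
Proof. by move=> x; apply/ffunP => i; rewrite ffunE inE. Qed.

(** [x] and [y] extend the same point of the smaller cube by the two values of coordinate [k], so
    equal restrictions would give [f x = f y]. *)
Lemma relevantP n (f : boolfun n) (k : 'I_n) (x y : cube n) :
  x k -> ~~ y k -> (forall i, i != k -> x i = y i) -> f x <> f y ->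
  relevant f k.
Proof.
move=> xk yk xy fxy eqf; apply: fxy.
have /ffunP/(_ [ffun j => x (lift k j)]) := eqf; rewrite !ffunE.
have -> : insert_coord k true [ffun j => x (lift k j)] = x.
  by apply/ffunP => i; rewrite ffunE; case: unliftP => [j|] ->; rewrite ?ffunE.
have -> // : insert_coord k false [ffun j => x (lift k j)] = y.
apply/ffunP => i; rewrite ffunE; case: unliftP => [j|] ->.
  by rewrite ffunE xy // eq_sym neq_lift.
exact/esym/negbTE.
Qed.

(** The outermost connective decides: a true literal settles a disjunction and a false one settles a
    conjunction. A lone literal is settled by making it true. *)
Lemma linear_read_once_fix n (f : boolfun n) : linear_read_once f ->
  (exists b, forall x, f x = b) \/
  exists (i : 'I_n) (b c : bool), forall x : cube n, x i = b -> f x = c.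
Proof.
case=> [|[t [_ ft]]]; [by left | right].
case: t ft => [i b|i b u|i b u] ft.
- by exists i, b, true => x; rewrite ft /= /eval_lit => ->; case: b ft.
- by exists i, b, true => x; rewrite ft /= /eval_lit => ->; case: b ft.
- by exists i, (~~ b), false => x; rewrite ft /= /eval_lit => ->; case: b ft.
Qed.

(** * Flips at a point and specification numbers *)

Definition flip n (f : boolfun n) (p : cube n) : boolfun n :=
  [ffun x => f x (+) (x == p)].

(** If [p] were outside [S], the flip would agree with [f] on [S] and yet differ from it at [p]. *)
Lemma specifies_flip n (F : boolfun n -> Prop) f S p :
  specifies F f S -> F (flip f p) -> p \in S.
Proof.
move=> spec Fp; apply/negP => /negP pS.
have /ffunP/(_ p) : flip f p = f.
  apply: spec => // x xS; rewrite ffunE; case: eqP => [xp|_]; last exact: addbF.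
  by rewrite xp (negbTE pS) in xS.
by rewrite ffunE eqxx; case: (f p).
Qed.

Lemma specification_numberE n (F : boolfun n -> Prop) f (S : {set cube n}) :
  specifies F f S -> (forall p, p \in S -> F (flip f p)) ->
  specification_number F f = #|S|.
Proof.
move=> specS flipS; rewrite /specification_number; case: arg_minnP.
  exact/asboolP/specifies_setT.
move=> T /asboolP specT minT; apply/eqP; rewrite eqn_leq minT; last exact/asboolP.
by apply/subset_leq_card/subsetP => p /flipS; apply: specifies_flip.
Qed.

(** * Weighted sums over the cube *)

Lemma threshold_nat (R : realType) n (f : boolfun n) (w : 'I_n -> nat) t :
  (forall x, f x = (t < \sum_i w i * x i)) -> threshold R f.
Proof.
move=> fE; exists (fun i => (w i)%:R%R), t%:R%R => x.
have -> : (\sum_i (w i)%:R * (x i)%:R = (\sum_i w i * x i)%:R :> R)%R.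
  by rewrite natr_sum; apply: eq_bigr => i _; rewrite natrM.
by rewrite ler_nat leqNgt fE; split=> [/negbT|/negbTE].
Qed.

Lemma threshold_sum_support (R : realType) n (w : 'I_n -> R) (x : cube n) :
  (\sum_i w i * (x i)%:R = \sum_(i in support x) w i)%R.
Proof.
rewrite [RHS]big_mkcond; apply: eq_bigr => i _; rewrite inE.
by case: (x i); rewrite ?mulr1 ?mulr0.
Qed.

(* Ordinals count from 0: [ord0] stands for x_1, [ord_max] for x_n and
   [middle m] for x_2, ..., x_(n-1), where n = m + 2. *)
Definition middle m : {set 'I_m.+2} := ~: [set ord0; ord_max].

(** [fn] is symmetric in the middle coordinates and sees them only through this number. *)
Definition weight m (x : cube m.+2) := #|support x :&: middle m|.

Lemma card_middle m : #|middle m| = m.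
Proof.
by have := cardsC [set ord0; ord_max : 'I_m.+2]; rewrite cards2 card_ord => -[].
Qed.

Lemma weight_le m (x : cube m.+2) : weight x <= m.
Proof. by rewrite -[leqRHS]card_middle subset_leq_card ?subsetIr. Qed.

Lemma in_middle m (i : 'I_m.+2) : (i \in middle m) = (0 < i < m.+1).
Proof.
by rewrite !inE -!val_eqE /=; move: (ltn_ord i); lia.
Qed.

Lemma weight_eq m (x : cube m.+2) : (weight x == m) = (middle m \subset support x).
Proof.
rewrite -{2}(card_middle m) /weight.
rewrite (eqn_leq #|_|) subset_leq_card ?subsetIr //=.
apply/idP/idP => [h|/setIidPr -> //].
by rewrite (sameP setIidPr eqP) eqEcard subsetIr.
Qed.

Lemma support_middle m (x : cube m.+2) :
  (support x :&: middle m == middle m) = (weight x == m).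
Proof. by rewrite weight_eq (sameP eqP setIidPr). Qed.

(** * Arithmetic form of [fn] and weights symmetric in the middle coordinates *)

Lemma coord_ord n (x : cube n) (i : 'I_n) : Defs.coord x i.+1 = x i.
Proof.
apply/existsP/idP => [[j /andP[/eqP[/val_inj ->]]] //|xi].
by exists i; rewrite eqxx.
Qed.

Lemma fnE m (x : cube m.+2) :
  fn m.+2 x = x ord0 && (0 < weight x) || x ord_max && (weight x == m).
Proof.
rewrite ffunE big_has big_all; congr (_ || _).
  rewrite card_gt0; apply/hasP/andP => [[k]|[x0 /set0Pn[i]]].
    rewrite mem_index_iota => /andP[k2 km] /andP[x0 /existsP[i /andP[/eqP ik xi]]].
    split; first by rewrite -coord_ord.
    by apply/set0Pn; exists i; rewrite in_setI in_middle inE xi /=; lia.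
  rewrite in_setI in_middle inE => /andP[xi im]; exists i.+1.
    by rewrite mem_index_iota; lia.
  by rewrite (coord_ord x i) xi andbT (coord_ord x ord0).
rewrite weight_eq; apply/allP/andP => [h|[xz /subsetP h] [|k]]; rewrite ?mem_index_iota //.
  have {}h (i : 'I_m.+2) : 0 < i -> x i.
    by move=> i0; rewrite -coord_ord h // mem_index_iota; move: (ltn_ord i); lia.
  split; first exact: h.
  by apply/subsetP => i; rewrite in_middle inE => /andP[/h].
rewrite !ltnS => /andP[k0 km].
pose i := Ordinal (km : k < m.+2); rewrite (coord_ord x i).
have [->//|iz] := eqVneq i ord_max.
have : i \in middle m by rewrite in_middle; move: iz; rewrite -val_eqE /=; lia.
by move/h; rewrite inE.
Qed.

Lemma sum_split m (w : 'I_m.+2 -> nat) (x : cube m.+2) :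
  \sum_i w i * x i =
  w ord0 * x ord0 + w ord_max * x ord_max + \sum_(i in middle m) w i * x i.
Proof.
rewrite (bigD1 ord0) //= (bigD1 ord_max) //= addnA; congr (_ + _).
by apply: eq_bigl => i; rewrite !inE negb_or.
Qed.

Definition weights m (a b c : nat) (i : 'I_m.+2) : nat :=
  if i == ord0 then a else if i == ord_max then c else b.

Lemma sum_weights m a b c (x : cube m.+2) :
  \sum_i weights a b c i * x i = a * x ord0 + c * x ord_max + b * weight x.
Proof.
rewrite sum_split /weights !eqxx /=; congr (_ + _).
rewrite /weight -sum1_card big_distrr /= [RHS]big_mkcond [LHS]big_mkcond.
apply: eq_bigr => i _; rewrite !inE negb_or.
case: (i == ord0); case: (i == ord_max); rewrite ?andbF //=.
by case: (x i) => /=; rewrite ?muln0.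
Qed.

(** Equality is split along the same three blocks as in [fnE], so that the values of a flip reduce
    to arithmetic. *)
Lemma eq_indicator m (x : cube m.+2) (A : {set 'I_m.+2}) :
  (x == indicator A) =
  [&& x ord0 == (ord0 \in A), x ord_max == (ord_max \in A)
    & support x :&: middle m == A :&: middle m].
Proof.
apply/eqP/and3P => [->|[/eqP x0 /eqP xz /eqP xm]].
  by rewrite indicatorK !ffunE !eqxx.
apply/ffunP => i; rewrite ffunE.
have [->//|i0] := eqVneq i ord0; have [->//|iz] := eqVneq i ord_max.
by have /setP/(_ i) := xm; rewrite !inE (negbTE i0) (negbTE iz) !andbT.
Qed.

(** * [fn] is threshold and positive *)

Lemma threshold_fn (R : realType) m : 2 <= m -> threshold R (fn m.+2).
Proof.
(* With these weights the zeros {x_1, x_n} and {x_2, ..., x_(n-1)} both reach the threshold [2 * m]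
   exactly. *)
move=> m2; apply: (@threshold_nat _ _ _ (weights (2 * m - 1) 2 1) (2 * m)) => x.
rewrite fnE sum_weights; move: (weight_le x).
by case: (x ord0); case: (x ord_max) => /=; lia.
Qed.

Lemma positive_fn m : positive (fn m.+2).
Proof.
move=> x y fx xy; have sub : support x \subset support y.
  by apply/subsetP => i; move: (xy i); rewrite !inE; case: (x i); case: (y i).
move: fx (xy ord0) (xy ord_max) (weight_le y).
have : weight x <= weight y by rewrite subset_leq_card ?setSI.
rewrite !fnE.
by case: (x ord0); case: (x ord_max); case: (y ord0); case: (y ord_max) => //=; lia.
Qed.

(** * Values of [fn] at small and large sets *)

Lemma fn_indicator m (A : {set 'I_m.+2}) :
  fn m.+2 (indicator A) =
  (ord0 \in A) && (0 < #|A :&: middle m|) ||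
  (ord_max \in A) && (#|A :&: middle m| == m).
Proof. by rewrite fnE /weight indicatorK !ffunE. Qed.

Lemma fn_pair m (i : 'I_m.+2) :
  i \in middle m -> fn m.+2 (indicator [set ord0; i]).
Proof.
move=> im; rewrite fn_indicator !inE eqxx /= (_ : 0 < _) // card_gt0.
by apply/set0Pn; exists i; rewrite in_setI im !inE eqxx orbT.
Qed.

Lemma fn_set1 m (i : 'I_m.+2) : 2 <= m -> fn m.+2 (indicator [set i]) = false.
Proof.
move=> m2; rewrite fn_indicator !inE.
have : #|[set i] :&: middle m| <= 1 by rewrite -(cards1 i) subset_leq_card ?subsetIl.
have [<-|_] /= := eqVneq ord0 i; last first.
  by move=> h; rewrite (ltn_eqF (leq_ltn_trans h m2)) andbF.
have -> : [set ord0] :&: middle m = set0.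
  by apply/setP => j; rewrite !inE; case: eqP.
by rewrite cards0; lia.
Qed.

Lemma fn_setC1 m (i : 'I_m.+2) : 2 <= m -> fn m.+2 (indicator (~: [set i])).
Proof.
move=> m2; rewrite fn_indicator !inE.
have [<-/=|i0 /=] := eqVneq ord0 i.
  by rewrite (setIidPr _) ?card_middle // setCS; apply/subsetP => j; rewrite !inE => ->.
rewrite setIC -setDE; apply/orP; left.
have := cardsD1 i (middle m); rewrite card_middle.
by move: #|_ :\ _| => k; case: (_ \in _); lia.
Qed.

(** * The essential points and what they force *)

(** For [2 <= m] these are all the minimal ones of [fn] and two maximal zeros, [middle m] and
    [[set ord0; ord_max]]. The other maximal zeros omit one middle coordinate from [~:
    [set ord0]]. *)
Definition essential_points m : {set {set 'I_m.+2}} :=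
  [set ~: [set ord0]; middle m] :|: [set [set ord0; i] | i in ~: [set ord0]].

Lemma card_essential_points m : #|essential_points m| = m.+3.
Proof.
rewrite cardsU (_ : _ :&: _ = set0) ?cards0 ?subn0; last first.
  apply/setP => A; rewrite in_setI in_set0; apply/negP => /andP[hA /imsetP[i _ Ai]].
  have : ord0 \in A by rewrite Ai !inE eqxx.
  by move: hA; rewrite !inE => /orP[] /eqP ->; rewrite !inE eqxx.
rewrite cards2 card_in_imset => [|i j].
  have -> : ~: [set ord0] != middle m.
    by apply/eqP => /setP/(_ ord_max); rewrite !inE eqxx.
  by have := cardsC [set ord0 : 'I_m.+2]; rewrite cards1 card_ord; lia.
rewrite !inE => i0 j0 /setP/(_ i).
by rewrite !inE eqxx orbT (negbTE i0) => /esym/eqP.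
Qed.

Lemma threshold_flip (R : realType) m (A : {set 'I_m.+2}) : 2 <= m ->
  A \in essential_points m -> threshold R (flip (fn m.+2) (indicator A)).
Proof.
move=> m2; rewrite !inE -orbA => /or3P[/eqP->|/eqP->|].
(* Without the one {x_2, ..., x_n} there remains x_1 together with some middle coordinate; x_n
   becomes irrelevant and gets weight 0. *)
- apply: (@threshold_nat _ _ _ (weights m 1 0) m) => x.
  rewrite ffunE fnE sum_weights eq_indicator !inE.
  have -> : ~: [set ord0] :&: middle m = middle m.
    by apply/setIidPr; rewrite setCS; apply/subsetP => i; rewrite !inE => ->.
  rewrite support_middle; move: (weight_le x).
  by case: (x ord0); case: (x ord_max) => /=; lia.
(* Now the middle block alone suffices, so x_n is again irrelevant. *)
- apply: (@threshold_nat _ _ _ (weights m.-1 1 0) m.-1) => x.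
  rewrite ffunE fnE sum_weights eq_indicator !inE setIid !eqxx.
  rewrite support_middle; move: (weight_le x).
  by case: (x ord0); case: (x ord_max) => /=; lia.
case/imsetP => i; rewrite !inE => i0 ->.
have [->|iz] := eqVneq i ord_max.
  (* Once {x_1, x_n} is a one, x_n behaves like a middle coordinate. *)
  apply: (@threshold_nat _ _ _ (weights m 1 1) m) => x.
  rewrite ffunE fnE sum_weights eq_indicator !inE !eqxx setICr -cards_eq0.
  rewrite -/(weight x); move: (weight_le x).
  by case: (x ord0); case: (x ord_max) => /=; lia.
(* Compared with [threshold_fn], the weights of x_1 and x_i and the threshold each drop by one;
   {x_1, x_i} then reaches the threshold without exceeding it. *)
pose w j := weights (2 * m - 2) 2 1 j - (j == i).
apply: (@threshold_nat _ _ _ w (2 * m - 1)) => x.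
have im : i \in middle m by rewrite !inE (negbTE i0).
(* The missing unit at [i] is added back on the left, which avoids truncated subtraction. *)
have sumw : \sum_j w j * x j + x i =
    (2 * m - 2) * x ord0 + 1 * x ord_max + 2 * weight x.
  rewrite -sum_weights (bigD1 i) //= [RHS](bigD1 i) //=.
  have -> : weights (2 * m - 2) 2 1 i = 2.
    by rewrite /weights (negbTE i0) (negbTE iz).
  have -> : w i = 1.
    by rewrite /w /weights eqxx (negbTE i0) (negbTE iz).
  have -> : \sum_(j | j != i) w j * x j =
      \sum_(j | j != i) weights (2 * m - 2) 2 1 j * x j.
    by apply: eq_bigr => j /negbTE ji; rewrite /w ji subn0.
  move: (\sum_(_ | _) _) => s; case: (x i) => /=; lia.
rewrite ffunE fnE eq_indicator !inE eqxx.
have -> : [set ord0; i] :&: middle m = [set i].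
  apply/setP => j; rewrite !inE; have [->|_] /= := eqVneq j ord0.
    by rewrite eq_sym (negbTE i0).
  by have [->|] := eqVneq j i; rewrite ?iz.
rewrite (eq_sym ord_max i) (negbTE iz) /=.
have -> : (support x :&: middle m == [set i]) = x i && (weight x == 1).
  apply/eqP/andP => [h|[xi /cards1P[j wj]]].
    have /setIP[] : i \in support x :&: middle m by rewrite h inE.
    by rewrite /weight h cards1 inE => ->.
  have : i \in support x :&: middle m by rewrite in_setI im inE xi.
  by rewrite wj inE => /eqP ->.
have xim : weight x = m -> x i.
  by move/eqP; rewrite weight_eq => /subsetP/(_ i im); rewrite inE.
have xi_gt0 : x i -> 0 < weight x.
  by move=> xi; rewrite card_gt0; apply/set0Pn; exists i; rewrite in_setI im inE xi.
move: sumw xim xi_gt0 (weight_le x); set s := \sum_j _.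
case: (x ord0); case: (x ord_max); case: (x i) => /= sumw xim xi_gt0; lia.
Qed.

Lemma specifies_essential_points (R : realType) m : 2 <= m ->
  specifies (@threshold R m.+2) (fn m.+2)
    [set indicator A | A in essential_points m].
Proof.
move=> m2 g [w [t gE]] gS.
pose W (A : {set 'I_m.+2}) := (\sum_(i in A) w i)%R.
have gW A : g (indicator A) = ~~ (W A <= t)%R.
  move: (gE (indicator A)); rewrite threshold_sum_support indicatorK -/(W A).
  by case: (g _); case: (_ <= _)%R => // -[h1 h2]; [have := h2 isT | have := h1 erefl].
have {gE}gS A : A \in essential_points m -> (W A <= t)%R = ~~ fn m.+2 (indicator A).
  by move=> hA; rewrite -gS ?gW ?negbK ?imset_f.
have W2 i : i != ord0 -> W [set ord0; i] = (w ord0 + w i)%R.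
  by move=> i0; rewrite /W big_setU1 ?big_set1 // inE eq_sym.
have WD (A : {set 'I_m.+2}) i : i \in A -> W A = (w i + W (A :\ i))%R.
  by move=> iA; rewrite /W (big_setD1 i).
have mid0 : middle m = ~: [set ord0] :\ ord_max.
  by apply/setP => i; rewrite !inE negb_or andbC.
have hA1 i : i != ord0 -> [set ord0; i] \in essential_points m.
  by move=> i0; apply/setUP; right; apply: imset_f; rewrite !inE.
have h0i i : i \in middle m -> (t < w ord0 + w i)%R.
  move=> im; have i0 : i != ord0 by move: im; rewrite !inE; case: eqP.
  by rewrite -W2 // real_ltNge ?num_real // gS ?hA1 // fn_pair.
have h0z : (w ord0 + w ord_max <= t)%R.
  by rewrite -W2 // gS ?hA1 // fn_indicator setICr cards0 !inE; lia.
have hmid : (W (middle m) <= t)%R.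
  by rewrite gS ?fn_indicator !inE ?eqxx ?orbT.
have hmidz : (t < w ord_max + W (middle m))%R.
  rewrite mid0 -WD ?inE // real_ltNge ?num_real // gS ?fn_setC1 //.
  by rewrite !inE eqxx.
(* Adding x_n to the middle block crosses the threshold; similarly, replacing x_n by x_i next to x_1
   crosses it, which gives [wi_gt]. *)
have wz_gt0 : (0 < w ord_max)%R by lra.
have wi_gt i : i \in middle m -> (w ord_max < w i)%R.
  by move=> /h0i; lra.
have midD i : i \in middle m -> (0 <= W (middle m :\ i))%R.
  move=> im; apply: sumr_ge0 => j; rewrite in_setD1 => /andP[_ /wi_gt].
  by lra.
(* For i = x_2, [w i + W (middle m :\ i) <= t < w ord0 + w i], so [w ord0] exceeds a nonnegative
   sum. *)
have w0_gt0 : (0 < w ord0)%R.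
  have im : inord 1 \in middle m by rewrite in_middle inordK; lia.
  by move: (h0i _ im) (midD _ im) hmid; rewrite (WD _ _ im); lra.
have w_gt0 i : (0 < w i)%R.
  have [->//|i0] := eqVneq i ord0; have [->//|iz] := eqVneq i ord_max.
  have := wi_gt i; rewrite !inE (negbTE i0) (negbTE iz) => /(_ isT); lra.
have Wle (A B : {set 'I_m.+2}) : A \subset B -> (W A <= W B)%R.
  move=> /setIidPr AB; rewrite /W [leRHS](big_setID A) /= AB lerDl.
  by apply: sumr_ge0 => i _; apply: ltW.
apply/ffunP => x; rewrite -(supportK x); move: (support x) => A.
rewrite gW; apply/idP/idP; rewrite -real_ltNge ?num_real //.
  (* Contrapositive: the weight of every zero of [fn] is bounded by that of {x_1, x_n} or of
     [middle m]. *)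
  apply: contraTT; rewrite -real_leNgt ?num_real // fn_indicator negb_or.
  have [A0 /=|A0 /= /nandP hA] := boolP (ord0 \in A).
    rewrite -leqNgt leqn0 cards_eq0 => /andP[/eqP Am _].
    apply: le_trans h0z; rewrite -W2 //; apply: Wle; apply/subsetP => i iA.
    by have /setP/(_ i) := Am; rewrite !inE iA /= => /negbFE.
  have Amid i : i \in A -> i != ord_max -> i \in middle m.
    move=> iA iz; rewrite !inE (negbTE iz) orbF.
    by apply: contraNneq A0 => <-.
  have [Az|Az] := boolP (ord_max \in A); last first.
    apply: le_trans hmid; apply/Wle/subsetP => i iA; apply: Amid => //.
    by apply: contraNneq Az => <-.
  case: hA => [|hA]; first by rewrite Az.
  (* Exchange: replacing x_n by the heavier missing x_i sends [A] into [middle m]. This settles the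
     maximal zeros that are not essential points. *)
  have /subsetPn[i im iA] : ~~ (middle m \subset A).
    apply: contra hA => /setIidPr ->; exact/eqP/card_middle.
  rewrite (WD _ _ Az); apply: le_trans hmid; rewrite (WD _ _ im).
  apply: lerD; first exact/ltW/wi_gt.
  apply/Wle/subsetP => j; rewrite !in_setD1 => /andP[jz jA].
  by rewrite Amid // andbT; apply: contraNneq iA => <-.
(* Every one of [fn] contains some {x_1, x_i} with [i] in the middle, or {x_2, ..., x_n};
   monotonicity of [W] concludes. *)
rewrite fn_indicator => /orP[/andP[A0]|/andP[Az /eqP hA]].
  rewrite card_gt0 => /set0Pn[i]; rewrite in_setI => /andP[iA im].
  apply: lt_le_trans (h0i i im) _; rewrite -W2.
    by apply/Wle/subsetP => j; rewrite !inE => /orP[] /eqP ->.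
  by move: im; rewrite !inE; case: eqP.
have midA : middle m \subset A.
  by rewrite (sameP setIidPr eqP) eqEcard subsetIr hA card_middle /=.
apply: lt_le_trans hmidz _; rewrite (WD A _ Az) lerD2l; apply/Wle/subsetP => i im.
by rewrite in_setD1 (subsetP midA) // andbT; move: im; rewrite !inE negb_or => /andP[].
Qed.

(** * Relevance of all variables and failure of read-onceness *)

(** Each variable lies in a minimal one of [fn], and deleting it there gives a zero. *)
Lemma depends_fn m : 2 <= m -> depends_on_all (fn m.+2).
Proof.
move=> m2 k; have [->|k0] := eqVneq k ord0.
  pose i : 'I_m.+2 := inord 1.
  have im : i \in middle m by rewrite in_middle inordK; lia.
  apply: (@relevantP _ _ _ (indicator [set ord0; i]) (indicator [set i])).
  - by rewrite ffunE !inE eqxx.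
  - by rewrite ffunE !inE; move: im; rewrite !inE eq_sym; case: eqP.
  - by move=> j /negbTE j0; rewrite !ffunE !inE j0.
  - by rewrite fn_pair // fn_set1.
have [->|kz] := eqVneq k ord_max.
  apply: (@relevantP _ _ _ (indicator (~: [set ord0])) (indicator (middle m))).
  - by rewrite ffunE !inE.
  - by rewrite ffunE !inE eqxx orbT.
  - by move=> j /negbTE jz; rewrite !ffunE !inE jz orbF.
  - by rewrite fn_setC1 // fn_indicator !inE !eqxx.
apply: (@relevantP _ _ _ (indicator [set ord0; k]) (indicator [set ord0])).
- by rewrite ffunE !inE eqxx orbT.
- by rewrite ffunE !inE.
- by move=> j /negbTE jk; rewrite !ffunE !inE jk orbF.
- by rewrite fn_set1 // fn_pair // !inE (negbTE k0).
Qed.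

(** [setT] and [[set i]] take different values with x_i = 1, as do [~: [set i]] and [set0] with x_i
    = 0, so fixing one variable never makes [fn] constant. *)
Lemma not_linear_read_once_fn m : 2 <= m -> ~ linear_read_once (fn m.+2).
Proof.
move=> m2 /linear_read_once_fix[[b fb]|[i [b [c fc]]]].
  have := fn_setC1 ord0 m2; rewrite fb -(fb (indicator [set ord0])).
  by rewrite fn_set1.
have fT : fn m.+2 (indicator setT).
  rewrite fn_indicator !inE setTI card_middle; lia.
have f0 : fn m.+2 (indicator set0) = false by rewrite fn_indicator !inE.
case: b fc => fc.
  have := fT; rewrite (fc (indicator setT)) ?ffunE ?inE //.
  by rewrite -(fc (indicator [set i])) ?fn_set1 // ffunE inE eqxx.
have := fn_setC1 i m2; rewrite (fc (indicator (~: [set i]))); last first.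
  by rewrite ffunE !inE eqxx.
by rewrite -(fc (indicator set0)) ?f0 // ffunE inE.
Qed.

Theorem theorem5 (R : realType) (n : nat) (hn : 4 <= n) :
  positive (fn n) /\
  threshold R (fn n) /\
  depends_on_all (fn n) /\
  ~ linear_read_once (fn n) /\
  ~ nested (fn n) /\
  specification_number (@threshold R n) (fn n) = n.+1.
Proof.
case: n hn => [|[|m]] // m2.
have nlro := @not_linear_read_once_fn m m2.
split; first exact: positive_fn.
split; first exact: threshold_fn.
split; first exact: depends_fn.
split=> //; split; first by case.
rewrite (specification_numberE (@specifies_essential_points R m m2)).
  by rewrite (card_imset _ (can_inj (@indicatorK _))) card_essential_points.
by move=> p /imsetP[A hA ->]; apply: threshold_flip.
Qed.
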